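(* For all processes $P,Q\in\mathcal P$: $P\sqsupseteq_{1}Q$ if and only if $P\sqsupseteq_{c}Q$; i.e. the strong 1-faster-than precongruence and the strong c-faster-than precongruence coincide.
   Context: TACS. Fix a countable set $\Lambda$ of action names; $\overline{\Lambda}=\{\overline a : a\in\Lambda\}$ with $\overline{\overline a}=a$; $\mathcal A=\Lambda\cup\overline\Lambda\cup\{\tau\}$ is the set of actions (ranged over by $\alpha$), and $a$ ranges over $\Lambda\cup\overline\Lambda$. Terms (set $\widehat{\mathcal P}$) are generated by $P::=\mathbf 0\mid x\mid \alpha.P\mid \sigma.P\mid P+P\mid P|P\mid P\backslash L\mid P[f]\mid \mu x.P$, where $x$ ranges over a countably infinite set of variables, $L\subseteq\mathcal A\setminus\{\tau\}$ is finite, and $f:\mathcal A\to\mathcal A$ satisfies $f(\tau)=\tau$, $f(\overline a)=\overline{f(a)}$ and $f(\alpha)\neq\alpha$ for only finitely many $\alpha$. $\mu x$ binds $x$; $P[Q/x]$ denotes substitution of $Q$ for the free occurrences of $x$. A variable is guarded in a term if each of its occurrences is in the scope of an action prefix $\alpha.\_$ (a $\sigma$-prefix does not count). In every term $\mu x.P$, $x$ must be guarded in $P$. Processes (set $\mathcal P$) are the closed terms. $\overline L=\{\overline a: a\in L\}$. Urgent sets: $\mathcal U(\sigma.P)=\mathcal U(\mathbf 0)=\mathcal U(x)=\emptyset$, $\mathcal U(\alpha.P)=\{\alpha\}$, $\mathcal U(P+Q)=\mathcal U(P)\cup\mathcal U(Q)$, $\mathcal U(P|Q)=\mathcal U(P)\cup\mathcal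 U(Q)\cup\{\tau\mid \mathcal U(P)\cap\overline{\mathcal U(Q)}\neq\emptyset\}$, $\mathcal U(P\backslash L)=\mathcal U(P)\setminus(L\cup\overline L)$, $\mathcal U(P[f])=\{f(\alpha):\alpha\in\mathcal U(P)\}$, $\mathcal U(\mu x.P)=\mathcal U(P)$. Action transitions $\xrightarrow{\alpha}$ are the least relations with: $\alpha.P\xrightarrow{\alpha}P$; if $P\xrightarrow{\alpha}P'$ then $\sigma.P\xrightarrow{\alpha}P'$, $\mu x.P\xrightarrow{\alpha}P'[\mu x.P/x]$, $P+Q\xrightarrow{\alpha}P'$, $Q+P\xrightarrow{\alpha}P'$, $P|Q\xrightarrow{\alpha}P'|Q$, $Q|P\xrightarrow{\alpha}Q|P'$, $P[f]\xrightarrow{f(\alpha)}P'[f]$, and $P\backslash L\xrightarrow{\alpha}P'\backslash L$ if $\alpha\notin L\cup\overline L$; if $P\xrightarrow{a}P'$ and $Q\xrightarrow{\overline a}Q'$ then $P|Q\xrightarrow{\tau}P'|Q'$. Clock transitions $\xrightarrow{\sigma}_i$ ($i\in\{1,2\}$) are the least relations with: $\mathbf 0\xrightarrow{\sigma}_i\mathbf 0$; $a.P\xrightarrow{\sigma}_i a.P$ for $a\in\Lambda\cup\overline\Lambda$; $\sigma.P\xrightarrow{\sigma}_iP$; if $P\xrightarrow{\sigma}_iP'$ then $\mu x.P\xrightarrow{\sigma}_iP'[\mu x.P/x]$, $P\backslash L\xrightarrow{\sigma}_iP'\backslash L$, $P[f]\xrightarrow{\sigma}_iP'[f]$; if $P\xrightarrow{\sigma}_iP'$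 and $Q\xrightarrow{\sigma}_iQ'$ then $P+Q\xrightarrow{\sigma}_iP'+Q'$, and $P|Q\xrightarrow{\sigma}_iP'|Q'$ provided $\tau\notin\mathcal U(P|Q)$; and, only for $i=2$: if $P\xrightarrow{\sigma}_2P'$ then $\sigma.P\xrightarrow{\sigma}_2P'$. $\mathcal R\subseteq\mathcal P\times\mathcal P$ is a strong 1-faster-than relation if for all $(P,Q)\in\mathcal R$, $\alpha\in\mathcal A$: (1) $P\xrightarrow{\alpha}P'$ implies $\exists Q'$. $Q\xrightarrow{\alpha}Q'$, $(P',Q')\in\mathcal R$; (2) $Q\xrightarrow{\alpha}Q'$ implies $\exists P'$. $P\xrightarrow{\alpha}P'$, $(P',Q')\in\mathcal R$; (3) $P\xrightarrow{\sigma}_1P'$ implies $\mathcal U(Q)\subseteq\mathcal U(P)$ and $\exists Q'$. $Q\xrightarrow{\sigma}_1Q'$, $(P',Q')\in\mathcal R$. $\mathcal R$ is a strong c-faster-than relation if it satisfies (1), (2) and (3') $P\xrightarrow{\sigma}_1P'$ implies $\mathcal U(Q)\subseteq\mathcal U(P)$ and $\exists Q'$. $Q\xrightarrow{\sigma}_2Q'$, $(P',Q')\in\mathcal R$. $P\sqsupseteq_1Q$ (resp. $P\sqsupseteq_cQ$) iff $(P,Q)$ lies in some strong 1-faster-than (resp. strong c-faster-than) relation. *)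

(* Defs.v *)
From HB Require Import structures.
From mathcomp Require Import all_boot finmap.

Set Implicit Arguments.
Unset Strict Implicit.
Unset Printing Implicit Defensive.

Local Open Scope fset_scope.

Section Tacs.

Variable Lam : countType.

(** Visible actions: names [a] and co-names [\overline a]. *)
Inductive label : Type :=
  | Name of Lam
  | CoName of Lam.

Definition label_sum (l : label) : Lam + Lam :=
  match l with Name a => inl a | CoName a => inr a end.
Definition sum_label (s : Lam + Lam) : label :=
  match s with inl a => Name a | inr a => CoName a end.
Lemma label_sumK : cancel label_sum sum_label. Proof. by case. Qed.
HB.instance Definition _ := Countable.copy label (can_type label_sumK).

Definition bar (l : label) : label :=
  match l with Name a => CoName a | CoName a => Name a end.

Inductive action : Type :=
  | Tau
  | Vis of label.

Definition action_option (x : action) : option label :=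
  match x with Tau => None | Vis l => Some l end.
Definition option_action (o : option label) : action :=
  match o with None => Tau | Some l => Vis l end.
Lemma action_optionK : cancel action_option option_action. Proof. by case. Qed.
HB.instance Definition _ := Countable.copy action (can_type action_optionK).

(** As complementation is defined on visible actions only, the requirement
    [f (\overline a) = \overline (f a)] includes that [f a] is visible. *)
Record relabelling : Type := Relabelling {
  relab :> action -> action;
  relab_tau : relab Tau = Tau;
  relab_bar : forall l : label, exists l' : label,
    relab (Vis l) = Vis l' /\ relab (Vis (bar l)) = Vis (bar l');
  relab_fin : exists A : {fset action}, forall x, relab x <> x -> x \in A
}.

(** Raw terms, up to renaming of bound variables: variables are de Bruijn
    indices, and [Mu P] binds index 0 in [P].  The guardedness requirement on
    recursion is imposed by [wf] below. *)
Inductive term : Type :=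
  | Nil
  | Var of nat
  | Pref of action & term
  | Sig of term
  | Sum of term & term
  | Par of term & term
  | Restr of term & {fset label}
  | Relab of term & relabelling
  | Mu of term.

Fixpoint guarded (n : nat) (P : term) : bool :=
  match P with
  | Nil => true
  | Var m => m != n
  | Pref _ _ => true
  | Sig P => guarded n P
  | Sum P Q => guarded n P && guarded n Q
  | Par P Q => guarded n P && guarded n Q
  | Restr P _ => guarded n P
  | Relab P _ => guarded n P
  | Mu P => guarded n.+1 P
  end.

Fixpoint wf (P : term) : bool :=
  match P with
  | Nil => true
  | Var _ => true
  | Pref _ P => wf P
  | Sig P => wf P
  | Sum P Q => wf P && wf Q
  | Par P Q => wf P && wf Q
  | Restr P _ => wf P
  | Relab P _ => wf P
  | Mu P => guarded 0 P && wf P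
  end.

(** All free variables of [P] are among [0, ..., n - 1]. *)
Fixpoint closed_at (n : nat) (P : term) : bool :=
  match P with
  | Nil => true
  | Var m => m < n
  | Pref _ P => closed_at n P
  | Sig P => closed_at n P
  | Sum P Q => closed_at n P && closed_at n Q
  | Par P Q => closed_at n P && closed_at n Q
  | Restr P _ => closed_at n P
  | Relab P _ => closed_at n P
  | Mu P => closed_at n.+1 P
  end.

Definition process (P : term) : bool := wf P && closed_at 0 P.

Definition up_ren (r : nat -> nat) (n : nat) : nat :=
  match n with 0 => 0 | m.+1 => (r m).+1 end.

Fixpoint rename (r : nat -> nat) (P : term) : term :=
  match P with
  | Nil => Nil
  | Var n => Var (r n)
  | Pref x P => Pref x (rename r P)
  | Sig P => Sig (rename r P)
  | Sum P Q => Sum (rename r P) (rename r Q)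
  | Par P Q => Par (rename r P) (rename r Q)
  | Restr P L => Restr (rename r P) L
  | Relab P f => Relab (rename r P) f
  | Mu P => Mu (rename (up_ren r) P)
  end.

Definition up_subst (s : nat -> term) (n : nat) : term :=
  match n with 0 => Var 0 | m.+1 => rename succn (s m) end.

Fixpoint subst (s : nat -> term) (P : term) : term :=
  match P with
  | Nil => Nil
  | Var n => s n
  | Pref x P => Pref x (subst s P)
  | Sig P => Sig (subst s P)
  | Sum P Q => Sum (subst s P) (subst s Q)
  | Par P Q => Par (subst s P) (subst s Q)
  | Restr P L => Restr (subst s P) L
  | Relab P f => Relab (subst s P) f
  | Mu P => Mu (subst (up_subst s) P)
  end.

(** [P[Q/x]] where [x] is index 0 of [P]; the binder of [x] being removed, the
    remaining indices are decremented. *)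
Definition subst0 (Q P : term) : term :=
  subst (fun n => match n with 0 => Q | m.+1 => Var m end) P.

Definition restricted (L : {fset label}) : {fset action} :=
  [fset Vis l | l in L] `|` [fset Vis (bar l) | l in L].

(** [\overline A]; the action [Tau] has no complement. *)
Definition bars (A : {fset action}) : {fset action} :=
  [fset Vis (bar l) | l in pmap action_option A].

Fixpoint urgent (P : term) : {fset action} :=
  match P with
  | Nil => fset0
  | Var _ => fset0
  | Pref x _ => [fset x]
  | Sig _ => fset0
  | Sum P Q => urgent P `|` urgent Q
  | Par P Q =>
      urgent P `|` urgent Q `|`
      (if urgent P `&` bars (urgent Q) == fset0 then fset0 else [fset Tau])
  | Restr P L => urgent P `\` restricted L
  | Relab P f => [fset (f : action -> action) x | x in urgent P]
  | Mu P => urgent P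
  end.

Inductive astep : action -> term -> term -> Prop :=
  | AsPref x P : astep x (Pref x P) P
  | AsSig x P P' : astep x P P' -> astep x (Sig P) P'
  | AsMu x P P' : astep x P P' -> astep x (Mu P) (subst0 (Mu P) P')
  | AsSumL x P Q P' : astep x P P' -> astep x (Sum P Q) P'
  | AsSumR x P Q P' : astep x P P' -> astep x (Sum Q P) P'
  | AsParL x P Q P' : astep x P P' -> astep x (Par P Q) (Par P' Q)
  | AsParR x P Q P' : astep x P P' -> astep x (Par Q P) (Par Q P')
  | AsRelab x P P' (f : relabelling) :
      astep x P P' -> astep (f x) (Relab P f) (Relab P' f)
  | AsRestr x P P' L :
      astep x P P' -> x \notin restricted L -> astep x (Restr P L) (Restr P' L)
  | AsSync l P Q P' Q' :
      astep (Vis l) P P' -> astep (Vis (bar l)) Q Q' ->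
      astep Tau (Par P Q) (Par P' Q').

Inductive clock : Type := Clock1 | Clock2.

Inductive cstep : clock -> term -> term -> Prop :=
  | CsNil i : cstep i Nil Nil
  | CsPref i l P : cstep i (Pref (Vis l) P) (Pref (Vis l) P)
  | CsSig i P : cstep i (Sig P) P
  | CsMu i P P' : cstep i P P' -> cstep i (Mu P) (subst0 (Mu P) P')
  | CsRestr i P P' L : cstep i P P' -> cstep i (Restr P L) (Restr P' L)
  | CsRelab i P P' f : cstep i P P' -> cstep i (Relab P f) (Relab P' f)
  | CsSum i P Q P' Q' :
      cstep i P P' -> cstep i Q Q' -> cstep i (Sum P Q) (Sum P' Q')
  | CsPar i P Q P' Q' :
      cstep i P P' -> cstep i Q Q' -> Tau \notin urgent (Par P Q) ->
      cstep i (Par P Q) (Par P' Q')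
  | CsSig2 P P' : cstep Clock2 P P' -> cstep Clock2 (Sig P) P'.

(** The two notions differ only in the clock relation [i] with which the slower
    process answers a [Clock1] step of the faster one. *)
Definition faster_than_rel (i : clock) (R : term -> term -> Prop) : Prop :=
  forall P Q, R P Q ->
    [/\ process P /\ process Q,
        forall x P', astep x P P' -> exists2 Q', astep x Q Q' & R P' Q',
        forall x Q', astep x Q Q' -> exists2 P', astep x P P' & R P' Q'
      & forall P', cstep Clock1 P P' ->
          urgent Q `<=` urgent P /\ exists2 Q', cstep i Q Q' & R P' Q'].

Definition strong_1_faster_than_rel := faster_than_rel Clock1.
Definition strong_c_faster_than_rel := faster_than_rel Clock2.

Definition faster_1 (P Q : term) : Prop :=
  exists2 R, strong_1_faster_than_rel R & R P Q.
Definition faster_c (P Q : term) : Prop :=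
  exists2 R, strong_c_faster_than_rel R & R P Q.

End Tacs.

(* Main.v *)
Require Import Defs.
From mathcomp Require Import all_boot finmap.

(* A type-2 clock step only lets more nested [Sig]s elapse than the type-1 step
   of the same process, so its target is [ahead] of the type-1 target.  Time
   steps lead to terms that are ahead of their source, and being ahead is
   preserved by matching steps (recursion is guarded, so that unfolding adds no
   initial moves); hence [ahead] is contained in [faster_1].  Composing
   [faster_c] with [faster_1] therefore gives a strong 1-faster-than relation:
   the type-2 answer of the middle process is replaced by its type-1 answer,
   the loss being absorbed by [faster_1]. *)

Set Implicit Arguments.
Unset Strict Implicit.
Unset Printing Implicit Defensive.

Local Open Scope fset_scope.

(** * Substitution, guardedness and closedness for de Bruijn terms *)

Section Substitution.

Variable Lam : countType.
Implicit Types (P Q T : term Lam) (s t : nat -> term Lam) (r : nat -> nat).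

Lemma eq_up_ren r r' : r =1 r' -> up_ren r =1 up_ren r'.
Proof. by move=> e [|n] //=; rewrite e. Qed.

Lemma eq_rename r r' P : r =1 r' -> rename r P = rename r' P.
Proof.
elim: P r r' => //= [n|x P IH|P IH|P IHP Q IHQ|P IHP Q IHQ|P IH L|P IH f|P IH]
  r r' e; rewrite ?e ?(IH _ _ e) ?(IHP _ _ e) ?(IHQ _ _ e) //.
by rewrite (IH _ _ (eq_up_ren e)).
Qed.

Lemma eq_up_subst s t : s =1 t -> up_subst s =1 up_subst t.
Proof. by move=> e [|n] //=; rewrite e. Qed.

Lemma eq_subst s t P : s =1 t -> subst s P = subst t P.
Proof.
elim: P s t => //= [x P IH|P IH|P IHP Q IHQ|P IHP Q IHQ|P IH L|P IH f|P IH]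
  s t e; rewrite ?(IH _ _ e) ?(IHP _ _ e) ?(IHQ _ _ e) //.
by rewrite (IH _ _ (eq_up_subst e)).
Qed.

Lemma subst_Var P : subst (@Var Lam) P = P.
Proof.
elim: P => //= [x P ->|P ->|P -> Q ->|P -> Q ->|P -> L|P -> f|P IH] //.
by rewrite (@eq_subst _ (@Var Lam)) ?IH // => -[].
Qed.

Lemma subst_rename r s P : subst s (rename r P) = subst (s \o r) P.
Proof.
elim: P r s => //= [x P IH|P IH|P IHP Q IHQ|P IHP Q IHQ|P IH L|P IH f|P IH]
  r s; rewrite ?IH ?IHP ?IHQ //.
by congr Mu; apply: eq_subst => -[].
Qed.

Lemma rename_rename r r' P : rename r (rename r' P) = rename (r \o r') P.
Proof.
elim: P r r' => //= [x P IH|P IH|P IHP Q IHQ|P IHP Q IHQ|P IH L|P IH f|P IH]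
  r r'; rewrite ?IH ?IHP ?IHQ //.
by congr Mu; apply: eq_rename => -[].
Qed.

Lemma rename_subst r s P : rename r (subst s P) = subst (rename r \o s) P.
Proof.
elim: P r s => //= [x P IH|P IH|P IHP Q IHQ|P IHP Q IHQ|P IH L|P IH f|P IH]
  r s; rewrite ?IH ?IHP ?IHQ //.
by congr Mu; apply: eq_subst => -[|n] //=; rewrite !rename_rename.
Qed.

Lemma subst_subst s t P : subst s (subst t P) = subst (subst s \o t) P.
Proof.
elim: P s t => //= [x P IH|P IH|P IHP Q IHQ|P IHP Q IHQ|P IH L|P IH f|P IH]
  s t; rewrite ?IH ?IHP ?IHQ //.
congr Mu; apply: eq_subst => -[|n] //=.
by rewrite subst_rename rename_subst; apply: eq_subst.
Qed.

(** Lets a substitution pass through the unfolded terms that [AsMu], [CsMu] and [AheadMu]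
    produce. *)
Lemma subst_subst0 s Q P :
  subst s (subst0 Q P) = subst0 (subst s Q) (subst (up_subst s) P).
Proof.
rewrite /subst0 !subst_subst; apply: eq_subst => -[|n] //=.
(* Index 0 does not occur in [rename succn (s n)], so instantiating it merely undoes the shift and
   acts as the identity substitution on [s n]. *)
by rewrite subst_rename -[LHS]subst_Var; apply: eq_subst.
Qed.

Lemma guarded_rename r n P :
  (forall m, guarded m P || (r m != n)) -> guarded n (rename r P).
Proof.
elim: P r n => //= [m|P IHP Q IHQ|P IHP Q IHQ|P IH] r n h.
- by have := h m; rewrite eqxx.
- by rewrite IHP ?IHQ // => m; have := h m; case: (guarded m P); case: (guarded m Q).
- by rewrite IHP ?IHQ // => m; have := h m; case: (guarded m P); case: (guarded m Q).
- by apply: IH => -[|m] /=; rewrite ?orbT // eqSS.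
Qed.

(** An unguarded [n] in the result must come from an unguarded [m] in [P] whose image exposes [n];
    the disjunction rules this out for each [m]. *)
Lemma guarded_subst s n P :
  (forall m, guarded m P || guarded n (s m)) -> guarded n (subst s P).
Proof.
elim: P s n => //= [m|P IHP Q IHQ|P IHP Q IHQ|P IH] s n h.
- by have := h m; rewrite eqxx.
- by rewrite IHP ?IHQ // => m; have := h m; case: (guarded m P); case: (guarded m Q).
- by rewrite IHP ?IHQ // => m; have := h m; case: (guarded m P); case: (guarded m Q).
- apply: IH => -[|m] /=; rewrite ?orbT //.
  case/orP: (h m) => [-> //|gs]; rewrite (@guarded_rename _ n.+1) ?orbT // => k.
  by rewrite eqSS; case: eqP => [->|]; rewrite ?gs ?orbT.
Qed.

Lemma guarded_up_subst s P : guarded 0 P -> guarded 0 (subst (up_subst s) P).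
Proof.
move=> g; apply: guarded_subst => -[|m] /=; first by rewrite g.
by rewrite guarded_rename ?orbT // => k; rewrite orbT.
Qed.

Lemma wf_rename r P : wf P -> wf (rename r P).
Proof.
elim: P r => //= [P IHP Q IHQ|P IHP Q IHQ|P IH] r /andP[h1 h2];
  rewrite ?IHP ?IHQ ?IH // andbT.
by apply: guarded_rename => -[|m] /=; rewrite ?h1 ?orbT.
Qed.

Lemma wf_subst s P : (forall n, wf (s n)) -> wf P -> wf (subst s P).
Proof.
elim: P s => //= [P IHP Q IHQ|P IHP Q IHQ|P IH] s hs.
- by case/andP=> h1 h2; rewrite IHP ?IHQ.
- by case/andP=> h1 h2; rewrite IHP ?IHQ.
- case/andP=> h1 h2; rewrite guarded_up_subst // IH // => -[|m] //=.
  exact: wf_rename.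
Qed.

Lemma closed_at_rename r k n P : (forall m, m < k -> r m < n) ->
  closed_at k P -> closed_at n (rename r P).
Proof.
elim: P r k n => //= [m|P IHP Q IHQ|P IHP Q IHQ|P IH] r k n h.
- exact: h.
- by case/andP=> h1 h2; rewrite (IHP _ _ _ h) ?(IHQ _ _ _ h).
- by case/andP=> h1 h2; rewrite (IHP _ _ _ h) ?(IHQ _ _ _ h).
- by apply: IH => -[|m] //=; apply: h.
Qed.

Lemma closed_at_subst s k n P : (forall m, m < k -> closed_at n (s m)) ->
  closed_at k P -> closed_at n (subst s P).
Proof.
elim: P s k n => //= [m|P IHP Q IHQ|P IHP Q IHQ|P IH] s k n h.
- exact: h.
- by case/andP=> h1 h2; rewrite (IHP _ _ _ h) ?(IHQ _ _ _ h).
- by case/andP=> h1 h2; rewrite (IHP _ _ _ h) ?(IHQ _ _ _ h).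
- by apply: IH => -[|m] //= lt_m; apply: closed_at_rename (h m lt_m).
Qed.

Lemma wf_subst0 Q P : wf Q -> wf P -> wf (subst0 Q P).
Proof. by move=> wfQ; apply: wf_subst => -[|m]. Qed.

Lemma closed_at_subst0 n Q P :
  closed_at n Q -> closed_at n.+1 P -> closed_at n (subst0 Q P).
Proof. by move=> cQ; apply: closed_at_subst => -[|m]. Qed.

End Substitution.

(** * Transitions and urgent sets under substitution *)

Section Transitions.

Variable Lam : countType.
Implicit Types (P Q T : term Lam) (s : nat -> term Lam) (x : action Lam).

Lemma wf_astep x P P' : astep x P P' -> wf P -> wf P'.
Proof.
elim=> {x P P'} //= [x P P' _ IH /andP[g h]|x P Q P' _ IH /andP[h1 h2]
  |x P Q P' _ IH /andP[h1 h2]|x P Q P' _ IH /andP[h1 h2]|x P Q P' _ IH /andP[h1 h2]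
  |l P Q P' Q' _ IHP _ IHQ /andP[h1 h2]]; rewrite ?IH ?IHP ?IHQ ?h1 ?h2 //.
by apply: wf_subst0; rewrite /= ?g ?IH.
Qed.

Lemma closed_at_astep n x P P' : astep x P P' -> closed_at n P -> closed_at n P'.
Proof.
move=> st; elim: st n => {x P P'} //= [x P P' _ IH n h|x P Q P' _ IH n /andP[h1 h2]
  |x P Q P' _ IH n /andP[h1 h2]|x P Q P' _ IH n /andP[h1 h2]
  |x P Q P' _ IH n /andP[h1 h2]
  |l P Q P' Q' _ IHP _ IHQ n /andP[h1 h2]]; rewrite ?IH ?IHP ?IHQ ?h1 ?h2 //.
by apply: closed_at_subst0 => //; apply: IH.
Qed.

Lemma process_astep x P P' : astep x P P' -> process P -> process P'.
Proof.
move=> st /andP[wP cP].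
by rewrite /process (wf_astep st wP) (closed_at_astep st cP).
Qed.

Lemma wf_cstep i P P' : cstep i P P' -> wf P -> wf P'.
Proof.
elim=> {i P P'} //= [i P P' _ IH /andP[g h]|i P Q P' Q' _ IHP _ IHQ /andP[h1 h2]
  |i P Q P' Q' _ IHP _ IHQ _ /andP[h1 h2]]; rewrite ?IHP ?IHQ //.
by apply: wf_subst0; rewrite /= ?g ?IH.
Qed.

Lemma closed_at_cstep n i P P' :
  cstep i P P' -> closed_at n P -> closed_at n P'.
Proof.
move=> st; elim: st n => {i P P'} //= [i P P' _ IH n h
  |i P Q P' Q' _ IHP _ IHQ n /andP[h1 h2]
  |i P Q P' Q' _ IHP _ IHQ _ n /andP[h1 h2]]; rewrite ?IHP ?IHQ //.
by apply: closed_at_subst0 => //; apply: IH.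
Qed.

Lemma process_cstep i P P' : cstep i P P' -> process P -> process P'.
Proof.
move=> st /andP[wP cP].
by rewrite /process (wf_cstep st wP) (closed_at_cstep st cP).
Qed.

Lemma cstep1_2 P P' : cstep Clock1 P P' -> cstep Clock2 P P'.
Proof.
move e: Clock1 => i st; elim: st e => {i P P'} //; by eauto using cstep.
Qed.

Lemma astep_subst s x P P' :
  astep x P P' -> astep x (subst s P) (subst s P').
Proof.
move=> st; elim: st s => {x P P'} /=; try by eauto using astep.
by move=> x P P' _ IH s; rewrite subst_subst0; apply: AsMu.
Qed.

(** Beyond the plain union there is the [Tau] of a possible synchronisation; a complementary pair of
    urgent actions survives in larger sets. *)
Lemma urgent_mono_par P P' Q Q' :
  urgent P `<=` urgent P' -> urgent Q `<=` urgent Q' ->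
  urgent (Par P Q) `<=` urgent (Par P' Q').
Proof.
move=> /fsubsetP hP /fsubsetP hQ; apply: fsetUSS.
  by apply: fsetUSS; apply/fsubsetP.
case: ifP => // /negbT/fset0Pn[x]; rewrite in_fsetI => /andP[xP xQ].
case: ifP => [/eqP e|_]; last exact: fsubset_refl.
have : x \in urgent P' `&` bars (urgent Q').
  rewrite in_fsetI hP //=; case/imfsetP: xQ => l /= hl ->; apply/imfsetP.
  exists l => //=; move: hl; rewrite !mem_pmap => /mapP[y yQ ->].
  by apply/mapP; exists y; rewrite ?hQ.
by rewrite e.
Qed.

(** Only an inclusion: an unguarded variable contributes nothing urgent, whereas the term replacing
    it may. *)
Lemma urgent_subst s P : urgent P `<=` urgent (subst s P).
Proof.
elim: P s => /= [|n|x P IH|P IH|P IHP Q IHQ|P IHP Q IHQ|P IH L|P IH f|P IH] s;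
  rewrite ?fsub0set ?fsubset_refl //.
- exact: fsetUSS.
- by have := urgent_mono_par (IHP s) (IHQ s).
- exact: fsetSD.
- exact/subset_imfset/fsubsetP/IH.
Qed.

(* The side condition says that [P] can only move if it does so without the
   help of the substituted terms, variables being unable to move. *)
Lemma astep_substE s x P T :
  (forall n, guarded n P \/ exists m, s n = Var Lam m) ->
  astep x (subst s P) T -> exists2 P', astep x P P' & T = subst s P'.
Proof.
elim: P s x T => /= [|n|y P IH|P IH|P IHP Q IHQ|P IHP Q IHQ|P IH L|P IH f|P IH]
  s x T h.
- by move=> st; inversion st.
- by case: (h n) => [|[m ->] st]; [rewrite eqxx | inversion st].
- by move=> st; inversion st; subst; exists P => //; constructor.
- move=> st; inversion st; subst.
  by have [||P' ??] := IH s x T => //; exists P' => //; constructor.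
- have hP n : guarded n P \/ exists m, s n = Var Lam m.
    by case: (h n) => [/andP[]|]; auto.
  have hQ n : guarded n Q \/ exists m, s n = Var Lam m.
    by case: (h n) => [/andP[]|]; auto.
  move=> st; inversion st; subst.
  + by have [||P' ??] := IHP s x T => //; exists P' => //; constructor.
  + by have [||P' ??] := IHQ s x T => //; exists P' => //; constructor.
- have hP n : guarded n P \/ exists m, s n = Var Lam m.
    by case: (h n) => [/andP[]|]; auto.
  have hQ n : guarded n Q \/ exists m, s n = Var Lam m.
    by case: (h n) => [/andP[]|]; auto.
  move=> st; inversion st; subst.
  + have [//|//|P1 ? ->] := IHP s x P'.
    by exists (Par P1 Q) => //; constructor.
  + have [//|//|P1 ? ->] := IHQ s x P'.
    by exists (Par P P1) => //; constructor.
  + have [//|//|P1 ? ->] := IHP s (Vis l) P'.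
    have [//|//|Q1 ? ->] := IHQ s (Vis (bar l)) Q'.
    by exists (Par P1 Q1) => //; econstructor; eauto.
- move=> st; inversion st; subst; have [//|//|P1 ? ->] := IH s x P'.
  by exists (Restr P1 L) => //; constructor.
- move=> st; inversion st; subst; have [//|//|P1 ? ->] := IH s x0 P'.
  by exists (Relab P1 f) => //; constructor.
- move=> st; inversion st; subst.
  have [|//|P1 ? ->] := IH (up_subst s) x P'.
    case=> [|n] /=; first by right; exists 0.
    by case: (h n) => [|[m ->]]; [left | right; exists m.+1].
  by exists (subst0 (Mu P) P1); [constructor | rewrite subst_subst0].
Qed.

(** Clock analogue of [astep_substE]: variables cannot let time pass either, and a prefix, with the
    guarded variables below it, stays unchanged. *)
Lemma cstep_substE s i P T :
  (forall n, guarded n P \/ exists m, s n = Var Lam m) ->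
  cstep i (subst s P) T -> exists2 P', cstep i P P' & T = subst s P'.
Proof.
elim: P s i T => /= [|n|y P IH|P IH|P IHP Q IHQ|P IHP Q IHQ|P IH L|P IH f|P IH]
  s i T h.
- by move=> st; inversion st; exists (Defs.Nil Lam) => //; constructor.
- by case: (h n) => [|[m ->] st]; [rewrite eqxx | inversion st].
- by move=> st; inversion st; subst; exists (Pref (Vis l) P) => //; constructor.
- move=> st; inversion st; subst; first by exists P => //; constructor.
  by have [||P' ??] := IH s Clock2 T => //; exists P' => //; constructor.
- have hP n : guarded n P \/ exists m, s n = Var Lam m.
    by case: (h n) => [/andP[]|]; auto.
  have hQ n : guarded n Q \/ exists m, s n = Var Lam m.
    by case: (h n) => [/andP[]|]; auto.
  move=> st; inversion st; subst.
  have [//|//|P1 ? ->] := IHP s i P'; have [//|//|Q1 ? ->] := IHQ s i Q'.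
  by exists (Sum P1 Q1) => //; constructor.
- have hP n : guarded n P \/ exists m, s n = Var Lam m.
    by case: (h n) => [/andP[]|]; auto.
  have hQ n : guarded n Q \/ exists m, s n = Var Lam m.
    by case: (h n) => [/andP[]|]; auto.
  move=> st; inversion st; subst.
  have [//|//|P1 ? ->] := IHP s i P'; have [//|//|Q1 ? ->] := IHQ s i Q'.
  exists (Par P1 Q1) => //; constructor=> //.
  (* The proviso on [Tau] holds after substitution, hence before it, where the urgent set is
     smaller. *)
  by apply: contraNN H5; apply/fsubsetP/(urgent_subst s (Par P Q)).
- move=> st; inversion st; subst; have [//|//|P1 ? ->] := IH s i P'.
  by exists (Restr P1 L) => //; constructor.
- move=> st; inversion st; subst; have [//|//|P1 ? ->] := IH s i P'.
  by exists (Relab P1 f) => //; constructor.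
- move=> st; inversion st; subst.
  have [|//|P1 ? ->] := IH (up_subst s) i P'.
    case=> [|n] /=; first by right; exists 0.
    by case: (h n) => [|[m ->]]; [left | right; exists m.+1].
  by exists (subst0 (Mu P) P1); [constructor | rewrite subst_subst0].
Qed.

End Transitions.

(** * Elapsed delays and their simulation properties *)

Section Ahead.

Variable Lam : countType.
Implicit Types (P Q T : term Lam) (s : nat -> term Lam) (x : action Lam).

(* [ahead P' P]: [P'] is [P] after some of its [Sig]s have elapsed; as letting
   time pass below [Mu] unfolds it once, there is no congruence rule for [Mu]. *)
Inductive ahead : term Lam -> term Lam -> Prop :=
  | AheadRefl P : ahead P P
  | AheadSig P P' : ahead P' P -> ahead P' (Sig P)
  | AheadSum P P' Q Q' :
      ahead P' P -> ahead Q' Q -> ahead (Sum P' Q') (Sum P Q)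
  | AheadPar P P' Q Q' :
      ahead P' P -> ahead Q' Q -> ahead (Par P' Q') (Par P Q)
  | AheadRestr P P' L : ahead P' P -> ahead (Restr P' L) (Restr P L)
  | AheadRelab P P' f : ahead P' P -> ahead (Relab P' f) (Relab P f)
  | AheadMu P P' : ahead P' P -> ahead (subst0 (Mu P) P') (Mu P).

Lemma ahead_subst s P P' : ahead P' P -> ahead (subst s P') (subst s P).
Proof.
move=> a; elim: a s => {P P'} /=; try by eauto using ahead.
by move=> P P' _ IH s; rewrite subst_subst0; apply: AheadMu.
Qed.

(** Makes the inversion lemmas for substitution applicable to [P'] when the body [P] of a recursion
    has advanced to [P']. *)
Lemma ahead_guarded n P P' : ahead P' P -> guarded n P -> guarded n P'.
Proof.
move=> a; elim: a n => {P P'} //= [P P' Q Q' _ IHP _ IHQ n /andP[h1 h2]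
  |P P' Q Q' _ IHP _ IHQ n /andP[h1 h2]|P P' _ IH n h]; rewrite ?IHP ?IHQ //.
(* Index 0 becomes [Mu P], where [n] is guarded by [h]. Index [m.+1] becomes [Var m], which matters
   only for [m = n]; then the induction hypothesis at [n.+1] applies. *)
apply: guarded_subst => -[|m] /=; first by rewrite h orbT.
by case: eqP => [->|_]; rewrite ?orbT // IH.
Qed.

(** An elapsed [Sig] uncovers actions that it kept from being urgent, and unfolding can only add
    further ones. *)
Lemma ahead_urgent P P' : ahead P' P -> urgent P `<=` urgent P'.
Proof.
elim=> {P P'} /= [P|P P' _ _|P P' Q Q' _ IHP _ IHQ|P P' Q Q' _ IHP _ IHQ
  |P P' L _ IH|P P' f _ IH|P P' _ IH].
- exact: fsubset_refl.
- exact: fsub0set.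
- exact: fsetUSS.
- exact: urgent_mono_par.
- exact: fsetSD.
- exact/subset_imfset/fsubsetP/IH.
- exact: fsubset_trans IH (urgent_subst _ _).
Qed.

(* As [P'] is as guarded as [P], its unfolding moves as [P'] itself does. *)
Lemma ahead_unfold_guarded P P' : ahead P' P -> guarded 0 P ->
  forall n, guarded n P' \/
    exists m, (if n is k.+1 then Var Lam k else Mu P) = Var Lam m.
Proof.
by move=> a g [|n]; [left; apply: ahead_guarded g | right; exists n].
Qed.

Lemma cstep_ahead i P P' : cstep i P P' -> ahead P' P.
Proof. by elim=> *; eauto using ahead. Qed.

(** Takes the place of transitivity of [ahead]. For [Mu], guardedness turns a step of the unfolded
    term into one of its body before substitution, so a single unfolding still suffices. *)
Lemma ahead_cstep i P P' P1 : ahead P' P -> wf P -> cstep i P' P1 -> ahead P1 P.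
Proof.
move=> a; elim: a i P1 => {P P'} /= [P|P P' _ IH|P P' Q Q' _ IHP _ IHQ
  |P P' Q Q' _ IHP _ IHQ|P P' L _ IH|P P' f _ IH|P P' a IH] i P1.
- by move=> _; apply: cstep_ahead.
- by move=> w st; apply: AheadSig; apply: IH st.
- by case/andP=> w1 w2 st; inversion st; subst; apply: AheadSum; eauto.
- by case/andP=> w1 w2 st; inversion st; subst; apply: AheadPar; eauto.
- by move=> w st; inversion st; subst; apply: AheadRestr; eauto.
- by move=> w st; inversion st; subst; apply: AheadRelab; eauto.
- case/andP=> g w /(cstep_substE (ahead_unfold_guarded a g))[P2 st ->].
  by apply: AheadMu; apply: IH st.
Qed.

Lemma ahead_astep x P P' P1' : ahead P' P -> wf P -> astep x P' P1' ->
  exists2 P1, astep x P P1 & ahead P1' P1.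
Proof.
move=> a; elim: a x P1' => {P P'} /= [P|P P' _ IH|P P' Q Q' a1 IHP a2 IHQ
  |P P' Q Q' a1 IHP a2 IHQ|P P' L _ IH|P P' f _ IH|P P' a IH] x P1'.
- by move=> _ st; exists P1' => //; constructor.
- by move=> w /(IH _ _ w)[P1 ??]; exists P1 => //; constructor.
- case/andP=> w1 w2 st; inversion st; subst.
  + by have [//|//|P1 ??] := IHP x P1'; exists P1 => //; constructor.
  + by have [//|//|P1 ??] := IHQ x P1'; exists P1 => //; constructor.
- case/andP=> w1 w2 st; inversion st; subst.
  + have [//|//|P1 ??] := IHP x P'0.
    by exists (Par P1 Q); constructor.
  + have [//|//|P1 ??] := IHQ x P'0.
    by exists (Par P P1); constructor.
  + have [//|//|P1 ??] := IHP (Vis l) P'0.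
    have [//|//|Q1 ??] := IHQ (Vis (bar l)) Q'0.
    by exists (Par P1 Q1); econstructor; eauto.
- move=> w st; inversion st; subst; have [//|//|P1 ??] := IH x P'0.
  by exists (Restr P1 L); constructor.
- move=> w st; inversion st; subst; have [//|//|P1 ??] := IH x0 P'0.
  by exists (Relab P1 f); constructor.
- case/andP=> g w /(astep_substE (ahead_unfold_guarded a g))[P2 st ->].
  have [P1 st1 a1] := IH _ _ w st.
  by exists (subst0 (Mu P) P1); [constructor | apply: ahead_subst].
Qed.

Lemma astep_ahead x P P' P1 : ahead P' P -> astep x P P1 ->
  exists2 P1', astep x P' P1' & ahead P1' P1.
Proof.
move=> a; elim: a x P1 => {P P'} /= [P|P P' _ IH|P P' Q Q' a1 IHP a2 IHQ
  |P P' Q Q' a1 IHP a2 IHQ|P P' L _ IH|P P' f _ IH|P P' a IH] x P1 st.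
- by exists P1 => //; constructor.
- by inversion st; subst; apply: IH.
- inversion st; subst.
  + by have [//|P1' ??] := IHP x P1; exists P1' => //; constructor.
  + by have [//|P1' ??] := IHQ x P1; exists P1' => //; constructor.
- inversion st; subst.
  + have [//|P1' ??] := IHP x P'0.
    by exists (Par P1' Q'); constructor.
  + have [//|P1' ??] := IHQ x P'0.
    by exists (Par P' P1'); constructor.
  + have [//|P1' ??] := IHP (Vis l) P'0.
    have [//|Q1' ??] := IHQ (Vis (bar l)) Q'0.
    by exists (Par P1' Q1'); econstructor; eauto.
- inversion st; subst; have [//|P1' ??] := IH x P'0.
  by exists (Restr P1' L); constructor.
- inversion st; subst; have [//|P1' ??] := IH x0 P'0.
  by exists (Relab P1' f); constructor.
- inversion st; subst; have [//|P1' ??] := IH x P'0.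
  (* The matching step of the advanced body survives its unfolding, since substitution preserves
     action steps. *)
  by exists (subst0 (Mu P) P1'); [apply: astep_subst | apply: ahead_subst].
Qed.

Lemma ahead_cstep1 P P' P1' : ahead P' P -> wf P -> cstep Clock1 P' P1' ->
  exists2 P1, cstep Clock1 P P1 & ahead P1' P1.
Proof.
move=> a; elim: a P1' => {P P'} /= [P|P P' a _|P P' Q Q' a1 IHP a2 IHQ
  |P P' Q Q' a1 IHP a2 IHQ|P P' L _ IH|P P' f _ IH|P P' a IH] P1'.
- by move=> _ st; exists P1' => //; constructor.
(* [Sig P] answers by dropping just its outer [Sig]: however far [P'] has advanced, its further step
   leaves it ahead of [P]. *)
- by move=> w st; exists P; [constructor | apply: ahead_cstep a w st].
- case/andP=> w1 w2 st; inversion st; subst.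
  have [//|//|P1 ??] := IHP P'0; have [//|//|Q1 ??] := IHQ Q'0.
  by exists (Sum P1 Q1); constructor.
- case/andP=> w1 w2 st; inversion st; subst.
  have [//|//|P1 ??] := IHP P'0; have [//|//|Q1 ??] := IHQ Q'0.
  exists (Par P1 Q1); constructor=> //.
  by apply: contraNN H5; apply/fsubsetP/urgent_mono_par; apply: ahead_urgent.
- move=> w st; inversion st; subst; have [//|//|P1 ??] := IH P'0.
  by exists (Restr P1 L); constructor.
- move=> w st; inversion st; subst; have [//|//|P1 ??] := IH P'0.
  by exists (Relab P1 f); constructor.
- case/andP=> g w /(cstep_substE (ahead_unfold_guarded a g))[P2 st ->].
  have [P1 st1 a1] := IH _ w st.
  by exists (subst0 (Mu P) P1); [constructor | apply: ahead_subst].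
Qed.

Lemma ahead_faster_1 P P' :
  process P -> process P' -> ahead P' P -> faster_1 P' P.
Proof.
move=> pP pP' a.
(* [ahead] also relates open terms, so it is cut down to processes. *)
exists (fun T Q => [/\ process T, process Q & ahead T Q]) => // {P P' pP pP' a}.
move=> P' P [pP' pP a]; have /andP[wP _] := pP; split=> // [x P1' st|x P1 st|P1' st].
- have [P1 st1 a1] := ahead_astep a wP st; exists P1 => //.
  by split=> //; [apply: process_astep st pP' | apply: process_astep st1 pP].
- have [P1' st1 a1] := astep_ahead a st; exists P1' => //.
  by split=> //; [apply: process_astep st1 pP' | apply: process_astep st pP].
- split; first exact: ahead_urgent.
  have [P1 st1 a1] := ahead_cstep1 a wP st; exists P1 => //.
  by split=> //; [apply: process_cstep st pP' | apply: process_cstep st1 pP].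
Qed.

(* The type-1 step stops where the type-2 step may go on letting time pass. *)
Lemma cstep2_1 P P2 : cstep Clock2 P P2 ->
  exists2 P1, cstep Clock1 P P1 & ahead P2 P1.
Proof.
move e: Clock2 => i st; elim: st e => {i P P2}.
- by move=> i _; exists (Defs.Nil Lam); constructor.
- by move=> i l P _; exists (Pref (Vis l) P); constructor.
- by move=> i P _; exists P; constructor.
- move=> i P P2 _ IH /IH[P1 ??].
  by exists (subst0 (Mu P) P1); [constructor | apply: ahead_subst].
- by move=> i P P2 L _ IH /IH[P1 ??]; exists (Restr P1 L); constructor.
- by move=> i P P2 f _ IH /IH[P1 ??]; exists (Relab P1 f); constructor.
- move=> i P Q P2 Q2 _ IHP _ IHQ e; have [P1 ??] := IHP e; have [Q1 ??] := IHQ e.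
  by exists (Sum P1 Q1); constructor.
- move=> i P Q P2 Q2 _ IHP _ IHQ u e; have [P1 ??] := IHP e.
  by have [Q1 ??] := IHQ e; exists (Par P1 Q1); constructor.
- by move=> P P2 st _ _; exists P; [constructor | apply: cstep_ahead st].
Qed.

End Ahead.

(** * Composition of the preorders and their coincidence *)

Section Coincidence.

Variable Lam : countType.
Implicit Types P Q T : term Lam.

(** Coinductive unfolding: the union of all faster-than relations satisfies their clauses. Keeping
    [i] general serves both preorders. *)
Lemma faster_is_rel i P Q :
  (exists2 R, @faster_than_rel Lam i R & R P Q) ->
  [/\ process P /\ process Q,
      forall x P', astep x P P' -> exists2 Q', astep x Q Q' &
        exists2 R, faster_than_rel i R & R P' Q',
      forall x Q', astep x Q Q' -> exists2 P', astep x P P' &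
        exists2 R, faster_than_rel i R & R P' Q'
    & forall P', cstep Clock1 P P' -> urgent Q `<=` urgent P /\
        exists2 Q', cstep i Q Q' & exists2 R, faster_than_rel i R & R P' Q'].
Proof.
move=> [R hR /hR[pp h1 h2 h3]]; split=> // [x P' st|x Q' st|P' st].
- by have [Q' ??] := h1 _ _ st; exists Q' => //; exists R.
- by have [P' ??] := h2 _ _ st; exists P' => //; exists R.
- by have [? [Q' ??]] := h3 _ st; split=> //; exists Q' => //; exists R.
Qed.

(** Plain composition works for [Clock1] because the middle term's answer is again a [Clock1] step,
    which the second relation can match. *)
Lemma faster_1_trans T P Q : faster_1 P T -> faster_1 T Q -> faster_1 P Q.
Proof.
move=> PT TQ; exists (fun P Q => exists2 T, faster_1 P T & faster_1 T Q);
  last by exists T.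
move=> {T PT TQ}P {}Q [T /faster_is_rel[[pP _] a1 a2 a3]].
move=> /faster_is_rel[[_ pQ] b1 b2 b3]; split=> // [x P' st|x Q' st|P' st].
- by have [T' /b1[Q' ??] ?] := a1 _ _ st; exists Q' => //; exists T'.
- by have [T' /a2[P' ??] ?] := b2 _ _ st; exists P' => //; exists T'.
- have [u [T' /b3[v [Q' ??]] ?]] := a3 _ st.
  by split; [apply: fsubset_trans u | exists Q' => //; exists T'].
Qed.

Lemma faster_1_c P Q : faster_1 P Q -> faster_c P Q.
Proof.
move=> [R hR RPQ]; exists R => // {P Q RPQ} P Q /hR[pp h1 h2 h3]; split=> // P'.
by move=> /h3[u [Q' st ?]]; split=> //; exists Q' => //; apply: cstep1_2.
Qed.

Lemma faster_c_1 P Q : process Q -> faster_c P Q -> faster_1 P Q.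
Proof.
move=> pQ PQ; exists (fun P Q => exists2 T, faster_c P T & faster_1 T Q); last first.
  (* [Q] itself serves as middle term, [faster_1] being reflexive on processes. *)
  by exists Q => //; apply: ahead_faster_1 => //; apply: AheadRefl.
move=> {pQ PQ}P {}Q [T /faster_is_rel[[pP pT] a1 a2 a3]].
move=> /faster_is_rel[[_ pQ] b1 b2 b3]; split=> // [x P' st|x Q' st|P' st].
- by have [T' /b1[Q' ??] ?] := a1 _ _ st; exists Q' => //; exists T'.
- by have [T' /a2[P' ??] ?] := b2 _ _ st; exists P' => //; exists T'.
(* The second relation matches only [Clock1] steps, so the [Clock2] answer [T2] is traded for a
   [Clock1] target [T1] that it is ahead of. *)
- have [u [T2 st2 PT2]] := a3 _ st; have [T1 st1 T21] := cstep2_1 st2.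
  have [v [Q1 stQ T1Q1]] := b3 _ st1.
  split; first exact: fsubset_trans u.
  (* The new middle term must be [T2], the one related to [P']; it reaches [Q1] through [T1] by
     transitivity. *)
  exists Q1 => //; exists T2 => //; apply: faster_1_trans T1Q1.
  by apply: ahead_faster_1 T21; [apply: process_cstep st1 pT
                                | apply: process_cstep st2 pT].
Qed.

End Coincidence.

Theorem theorem19 (Lam : countType) (P Q : term Lam)
    (hP : process P) (hQ : process Q) :
  faster_1 P Q <-> faster_c P Q.
Proof. by split; [apply: faster_1_c | apply: faster_c_1]. Qed.
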